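(* Let $(X,p)$ be a compact pseudometric space, and let $T:X\to X$ be a homeomorphism that is $L$-Lipschitz with respect to $p$, where $L>1$. Suppose $\mu$ is a regular Borel probability measure on $X$ such that $T$ is ergodic with respect to $\mu$. Let $\mathcal{E}=\{E_d\}_{d\in\mathcal{D}}$ be a generator of $(X,T)$ such that for $\mu$-almost all $x\in X$ there exists $\gamma_x\in\mathbb{R}$ with $\operatorname{diam}(C_k(x))\le\gamma_x\cdot L^{-k}$ for all $k\in\mathbb{N}$. Fix $f\in C(X)$. Then $$\frac1k\sum_{i=0}^{k-1}\alpha_{C_k(x)}\left(T^i f\right)\;\xrightarrow{k\to\infty}\;\int f\,\mathrm{d}\mu$$ for $\mu$-almost all $x\in X$.
   Context: A pseudometric satisfies the axioms of a metric except that $p(x,y)=0$ need not imply $x=y$; topology, continuity, compactness, Borel sets and diameters are taken with respect to $p$. $L$-Lipschitz means $p(Tx,Ty)\le L\,p(x,y)$ for all $x,y$. Ergodic includes that $\mu$ is $T$-invariant. $T^i f$ denotes $f\circ T^i$; $C(X)$ is the space of complex-valued continuous functions. A generator is a finite measurable partition $\{E_d\}_{d\in\mathcal{D}}$ of $X$ ($\mathcal{D}$ a finite index set) such that $\{T^iE_d:i\in\mathbb{Z},d\in\mathcal{D}\}$ generates the Borel $\sigma$-algebra. $C_k(x)=\bigcap_{i=0}^{k-1}T^{-i}E_{d_i(x)}$, where $d_i(x)\in\mathcal{D}$ is determined by $T^ix\in E_{d_i(x)}$. For a measurable set $F$ with $\mu(F)>0$, $\alpha_F(f)=\frac1{\mu(F)}\int_Ff\,\mathrm{d}\mu$.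 For almost every $x$, $\mu(C_k(x))>0$ for all $k$, so the averages are defined for almost every $x$. *)

(* Defs.v *)
From HB Require Import structures.
From mathcomp Require Import all_boot all_order all_algebra.
From mathcomp Require Import all_classical all_reals all_analysis.
From mathcomp Require Import complex.

Set Implicit Arguments.
Unset Strict Implicit.
Unset Printing Implicit Defensive.

Import Order.TTheory GRing.Theory Num.Theory.
Import numFieldNormedType.Exports.

Local Open Scope classical_set_scope.
Local Open Scope ring_scope.

(* A pseudoMetricType only provides balls and the topology they generate; this
   says that p is a pseudometric and that those balls are the open balls of p.
   Non-negativity of p follows from the first three clauses. *)
Definition is_pseudometric (R : realType) (X : pseudoMetricType R)
    (p : X -> X -> R) :=
  [/\ forall x, p x x = 0,
      forall x y, p x y = p y x,
      forall x y z, p x z <= p x y + p y z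
    & forall x e, ball x e = [set y | p x y < e]].

(* Extended-real valued, with value -oo on set0. *)
Definition diam (R : realType) (X : Type) (p : X -> X -> R) (A : set X)
    : \bar R :=
  ereal_sup [set (p z.1 z.2)%:E | z in A `*` A].

Definition lipschitz_wrt (R : realType) (X : Type) (p : X -> X -> R) (L : R)
    (T : X -> X) :=
  forall x y, p (T x) (T y) <= L * p x y.

Definition homeomorphism (X : topologicalType) (T : X -> X) :=
  continuous T /\
  exists S : X -> X, [/\ cancel T S, cancel S T & continuous S].

Notation borel X := (g_sigma_algebraType (@open X)).

(* X need not be Hausdorff, so compact sets need not be Borel: inner
   approximation is by compact Borel sets. *)
Definition regular_measure (R : realType) (X : pseudoPMetricType R)
    (mu : {measure set (borel X) -> \bar R}) :=
  forall A : set (borel X), measurable A ->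
    mu A = ereal_inf [set mu U | U in [set U : set X | open U /\ A `<=` U]] /\
    mu A = ereal_sup [set mu K | K in
      [set K : set X | [/\ compact K, measurable (K : set (borel X))
                         & K `<=` A]]].

Definition ergodic d (Y : measurableType d) (R : realType)
    (mu : probability Y R) (T : Y -> Y) :=
  [/\ measurable_fun setT T,
      forall A, measurable A -> mu (T @^-1` A) = mu A
    & forall A, measurable A -> T @^-1` A = A -> mu A = 0%E \/ mu A = 1%E].

(* T^i A for i in Z, avoiding an explicit inverse of T: Negz n stands for the
   exponent - (n + 1), whose image of A is the preimage under T^(n + 1). *)
Definition image_iterz (X : Type) (T : X -> X) (i : int) (A : set X) : set X :=
  match i with
  | Posz n => iter n T @` A
  | Negz n => iter n.+1 T @^-1` A
  end.

(* Cells of the partition are allowed to be empty. *)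
Definition generator (R : realType) (X : pseudoPMetricType R) (T : X -> X)
    (D : finType) (E : D -> set X) :=
  [/\ forall d, measurable (E d : set (borel X)),
      trivIset setT E,
      \bigcup_d E d = setT
    & <<s [set A | exists (i : int) (d : D), A = image_iterz T i (E d)] >>
      = @measurable _ (borel X)].

Definition cylinder (X : Type) (T : X -> X) (D : finType) (E : D -> set X)
    (d : nat -> X -> D) (k : nat) (x : X) : set X :=
  \bigcap_(i in `I_k) (iter i T @^-1` E (d i x)).

Definition cintegral d (Y : measurableType d) (R : realType)
    (mu : {measure set Y -> \bar R}) (F : set Y) (f : Y -> R[i]) : R[i] :=
  ((\int[mu]_(x in F) complex.Re (f x)) +i*
   (\int[mu]_(x in F) complex.Im (f x)))%C.

Definition average d (Y : measurableType d) (R : realType)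
    (mu : {measure set Y -> \bar R}) (F : set Y) (f : Y -> R[i]) : R[i] :=
  ((fine (mu F))^-1)%:C%C * cintegral mu F f.

(* Main.v *)
Require Import Defs.
From HB Require Import structures.
From mathcomp Require Import all_boot all_order all_algebra.
From mathcomp Require Import all_classical all_reals all_analysis.
From mathcomp Require Import complex.
From mathcomp Require Import measurable_realfun ring lra.

Set Implicit Arguments.
Unset Strict Implicit.
Unset Printing Implicit Defensive.

Import Order.TTheory GRing.Theory Num.Theory.
Import numFieldNormedType.Exports.

Local Open Scope classical_set_scope.
Local Open Scope ring_scope.

(* If y lies in C_k(x), then p(T^i x, T^i y) <= L^i p(x, y) <= c L^-(k - i), so
   by uniform continuity f (T^i y) is close to f (T^i x) for all i < k but a
   bounded number of i close to k. Hence the averages over C_k(x) are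
   asymptotic to the Birkhoff averages of f at x, and the theorem follows from
   the pointwise ergodic theorem for bounded functions. The latter is reduced
   to the claim that the Birkhoff sums of a function with negative integral are
   almost everywhere bounded above. *)

(** * Integrals of bounded functions and iterates of a measurable map *)

Lemma bounded_integrable d (Y : measurableType d) (R : realType)
    (mu : probability Y R) (A : set Y) (g : Y -> R) (B : R) :
  measurable A -> measurable_fun setT g -> (forall x, `|g x| <= B) ->
  mu.-integrable A (EFin \o g).
Proof.
move=> mA mg gB; apply: measurable_bounded_integrable => //.
- by rewrite (le_lt_trans (probability_le1 mu mA))// ltry.
- exact: measurable_funTS.
- by exists B; split; [exact: num_real|move=> M /ltW BM x _; exact: le_trans BM].
Qed.

(** By invariance, the pushforward of [mu] under [T] is [mu] itself. *)
Lemma Rintegral_comp d (Y : measurableType d) (R : realType)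
    (mu : probability Y R) (T : Y -> Y) (g : Y -> R) (B : R) :
  measurable_fun setT T ->
  (forall A, measurable A -> mu (T @^-1` A) = mu A) ->
  measurable_fun setT g -> (forall x, `|g x| <= B) ->
  \int[mu]_x g (T x) = \int[mu]_x g x.
Proof.
move=> mT Tmu mg gB; rewrite /Rintegral; congr fine.
have := @integral_pushforward _ _ _ _ R T mT mu setT (EFin \o g).
rewrite preimage_setT => <- //.
- by apply: eq_measure_integral => A mA _; exact: Tmu.
- exact/measurable_EFinP.
- apply: (@bounded_integrable _ _ _ _ _ (g \o T) B) => //=.
  exact: measurableT_comp.
Qed.

Lemma measurable_iter d (Y : measurableType d) (T : Y -> Y) n :
  measurable_fun setT T -> measurable_fun setT (iter n T).
Proof.
move=> mT; elim: n => [|n IHn]; first exact: measurable_id.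
exact: (measurableT_comp mT IHn).
Qed.

(** * Maximal Birkhoff sums and the one-sided bound *)

Section one_sided_ergodic_theorem.
Context d (Y : measurableType d) (R : realType).
Variables (T : Y -> Y) (g : Y -> R).

(* The maximum of the Birkhoff sums of length at most n, including the empty
   one. *)
Fixpoint max_birkhoff_sum (n : nat) (x : Y) : R :=
  if n is m.+1 then Num.max 0 (g x + max_birkhoff_sum m (T x)) else 0.

Local Notation M := max_birkhoff_sum.

Lemma max_birkhoff_sum_ge0 n x : 0 <= M n x.
Proof. by case: n => //= n; rewrite le_max lexx. Qed.

Lemma max_birkhoff_sumS n x : M n x <= M n.+1 x.
Proof.
elim: n x => [|n IHn] x; first exact: max_birkhoff_sum_ge0.
rewrite [M n.+1 x]/= [M n.+2 x]/= ge_max le_max lexx /= le_max.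
by rewrite lerD2l IHn orbT.
Qed.

Lemma max_birkhoff_sum_homo x : {homo M^~ x : m n / (m <= n)%N >-> m <= n}.
Proof.
by apply: homo_leq => [//|? ? ?|n]; [exact: le_trans|exact: max_birkhoff_sumS].
Qed.

Lemma birkhoff_sum_le_max n x : \sum_(i < n) g (iter i T x) <= M n x.
Proof.
elim: n x => [|n IHn] x; first by rewrite big_ord0.
rewrite big_ord_recl /= le_max lerD2l; apply/orP; right.
rewrite (eq_bigr (fun i : 'I_n => g (iter i T (T x)))); first exact: IHn.
by move=> i _; rewrite -iterSr.
Qed.

(** The bound may grow with [n], since it only serves to integrate each [M n] separately. *)
Lemma max_birkhoff_sum_bounded (B : R) n x :
  (forall x, `|g x| <= B) -> `|M n x| <= B *+ n.
Proof.
move=> gB; have B0 : 0 <= B by rewrite (le_trans _ (gB x)).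
rewrite ger0_norm ?max_birkhoff_sum_ge0//; elim: n x => [|n IHn] x //=.
rewrite ge_max mulrn_wge0//= mulrS lerD//.
by rewrite (le_trans (ler_norm _)).
Qed.

Lemma measurable_max_birkhoff_sum n :
  measurable_fun setT T -> measurable_fun setT g -> measurable_fun setT (M n).
Proof.
move=> mT mg; elim: n => [|n IHn] /=; first exact: measurable_cst.
apply: measurable_maxr; first exact: measurable_cst.
by apply: measurable_funD => //; exact: (measurableT_comp IHn mT).
Qed.

Let A := \bigcap_N \bigcup_n [set x | N%:R < M n x].

(** [M n.+1 x] is the positive part of [g x + M n (T x)], so the maxima at [x] and at [T x] are both
    bounded or both unbounded. In each direction the threshold [N] is raised by more than [|g x|] to
    absorb the term [g x]. *)
Lemma max_birkhoff_sum_unbounded_invariant : T @^-1` A = A.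
Proof.
apply/seteqP; split=> x Ax N _.
  have [n _ /= nN] := Ax (N + Num.truncn (`|g x|)).+1 I.
  exists n.+1 => //=; rewrite lt_max; apply/orP; right.
  have := truncnS_gt `|g x|.
  have : - g x <= `|g x| by rewrite -normrN ler_norm.
  move: nN; rewrite -addnS natrD; lra.
have [[|n] _ /= nN] := Ax (N + Num.truncn (`|g x|)).+1 I.
  by move: nN; rewrite ltNge ler0n.
exists n => //=; move: nN; rewrite lt_max ltNge ler0n /=.
have := truncnS_gt `|g x|; have : g x <= `|g x| by rewrite ler_norm.
rewrite -addnS natrD; lra.
Qed.

(* Where the maxima M n tend to +oo, M n.+1 - M n \o T = max (- M n \o T) g
   tends to g; its integral is nonnegative by invariance and monotonicity. So
   the invariant set A of those points cannot be of full measure. *)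
Lemma birkhoff_sum_upper_bounded (mu : probability Y R) (B : R) :
  ergodic mu T -> measurable_fun setT g -> (forall x, `|g x| <= B) ->
  \int[mu]_x g x < 0 ->
  {ae mu, forall x, exists C : R,
    forall n, \sum_(i < n) g (iter i T x) <= C}.
Proof.
move=> [mT Tmu Terg] mg gB g_lt0.
have mM n := measurable_max_birkhoff_sum n mT mg.
have mA : measurable A.
  apply: bigcap_measurable => // N _; apply: bigcup_measurable => n _.
  rewrite -[X in measurable X]setTI.
  have -> : [set x | N%:R < M n x] = M n @^-1` `]N%:R, +oo[.
    by apply/seteqP; split=> x /=; rewrite in_itv/= andbT.
  exact: mM.
have := Terg A mA max_birkhoff_sum_unbounded_invariant; case => [A0|A1].
  exists A; split => // x /= Cx; apply: contrapT => Ax; apply: Cx.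
  have [N NM] : exists N : nat, forall n, M n x <= N%:R.
    apply: contrapT => /forallNP H; apply: Ax => N _.
    apply: contrapT => H'; apply: (H N) => n; rewrite leNgt; apply/negP => nN.
    by apply: H'; exists n.
  by exists N%:R => n; rewrite (le_trans (birkhoff_sum_le_max n x)).
exfalso.
pose h n x := Num.max (- M n (T x)) (g x).
have hE n x : h n x = M n.+1 x - M n (T x).
  by rewrite /h /= addr_maxl sub0r addrK.
(* This bound is uniform in [n], as dominated convergence requires: [h n x] is at least [g x], and
   at most [max 0 (g x)] because [M n (T x)] is nonnegative. *)
have hB n x : `|h n x| <= B.
  have := gB x; rewrite /h; have := max_birkhoff_sum_ge0 n (T x).
  rewrite !ler_norml; move: (M n (T x)) (g x) => m y.
  by case: (lerP (- m) y); lra.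
have mh n : measurable_fun setT (h n).
  apply: measurable_maxr => //; apply: measurableT_comp => //.
  exact: (measurableT_comp (mM n) mT).
have ih n : 0 <= \int[mu]_x h n x.
  under eq_Rintegral do rewrite hE.
  have iM k : mu.-integrable setT (EFin \o M k).
    apply: (@bounded_integrable _ _ _ _ _ _ (B *+ k)) => // x.
    exact: max_birkhoff_sum_bounded.
  rewrite RintegralB//; last first.
    apply: (@bounded_integrable _ _ _ _ _ (M n \o T) (B *+ n)) => //.
      exact: (measurableT_comp (mM n) mT).
    by move=> x; exact: max_birkhoff_sum_bounded.
  rewrite (@Rintegral_comp _ _ _ _ _ _ (B *+ n))//; last first.
    by move=> x; exact: max_birkhoff_sum_bounded.
  rewrite subr_ge0 le_Rintegral// => x _; exact: max_birkhoff_sumS.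
have h_cvg : {ae mu, forall x, setT x ->
    (fun n => (h n x)%:E) @ \oo --> (g x)%:E}.
  exists (~` A); split; first exact: measurableC.
    by rewrite probability_setC// A1 subee.
  move=> x /= Cx Ax; apply: Cx => _.
  move: Ax; rewrite -max_birkhoff_sum_unbounded_invariant => Ax.
  (* Once [M n (T x)] exceeds [|g x|], the maximum in [h] is [g x]; the sequence is eventually
     constant. *)
  have [n _ /= nN] := Ax (Num.truncn (`|g x|)).+1 I.
  apply: cvg_near_cst; exists n => // k /= nk; congr EFin.
  apply/max_idPr; rewrite lerNl.
  have : M n (T x) <= M k (T x) by exact: max_birkhoff_sum_homo.
  have := truncnS_gt `|g x|; have : - g x <= `|g x| by rewrite -normrN ler_norm.
  lra.
have [] := @dominated_convergence _ _ _ mu setT measurableT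
  (fun n => EFin \o h n) (EFin \o g) (cst B%:E) _ _ h_cvg.
- by move=> n; exact/measurable_EFinP.
- exact/measurable_EFinP.
- exact: (@bounded_integrable _ _ _ _ _ (cst B) `|B|).
- by apply: aeW => x n _; rewrite /= lee_fin hB.
move=> _ _ cvgI.
have : (0%:E <= \int[mu]_x (EFin \o g) x)%E.
  rewrite -(cvg_lim _ cvgI)//; apply: lime_ge.
    by apply/cvg_ex; eexists; exact: cvgI.
  apply: nearW => n /=.
  rewrite -(@fineK _ (\int[mu]_x (h n x)%:E)%E) ?lee_fin ?ih//.
  apply: integrable_fin_num => //; exact: (@bounded_integrable _ _ _ _ _ _ B).
by move=> /fine_ge0; rewrite leNgt g_lt0.
Qed.

End one_sided_ergodic_theorem.

(** * The pointwise ergodic theorem for bounded functions *)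

Section ergodic_theorem.
Context d (Y : measurableType d) (R : realType) (mu : probability Y R).
Variables (T : Y -> Y).
Hypothesis erg : ergodic mu T.

(** Subtracting from [g] slightly more than its integral gives a negative integral, so the new
    Birkhoff sums are bounded above by some [C], and [C / n] tends to 0. The excesses [1 / (m + 1)]
    form a countable family, so a single null set serves all [e]. *)
Lemma birkhoff_average_upper_bounded (g : Y -> R) (B : R) :
  measurable_fun setT g -> (forall x, `|g x| <= B) ->
  {ae mu, forall x, forall e, 0 < e -> \forall n \near \oo,
    n%:R^-1 * \sum_(i < n) g (iter i T x) <= \int[mu]_x g x + e}.
Proof.
move=> mg gB; set I := \int[mu]_x g x.
have : {ae mu, forall x, forall m, exists C : R,
    forall n, \sum_(i < n) (g (iter i T x) - (I + m.+1%:R^-1)) <= C}.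
  apply/ae_foralln => m; set c := I + _.
  apply: (@birkhoff_sum_upper_bounded _ _ _ _ (fun x => g x - c) mu
    (B + `|c|)) => //.
  - exact: measurable_funB.
  - by move=> x; rewrite (le_trans (ler_normB _ _))// lerD2r.
  - rewrite RintegralB//; last 2 first.
    + exact: (@bounded_integrable _ _ _ _ _ _ B).
    + exact: (@bounded_integrable _ _ _ _ _ (cst c) `|c|).
    rewrite Rintegral_cst//.
    rewrite (_ : fine _ = 1); last exact: (congr1 fine (probability_setT mu)).
    rewrite mulr1 -/I /c.
    have : 0 < (m.+1%:R^-1 : R) by rewrite invr_gt0.
    by set k := _^-1; lra.
apply: filterS => x H e e0.
have e20 : 0 < e / 2 by rewrite divr_gt0.
(* This [m] makes the excess [1 / (m + 1)] at most [e / 2]; the threshold on [n] below makes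
   [|C| / n] at most [e / 2]. *)
have [C HC] := H (Num.truncn (e / 2)^-1).
exists (Num.truncn (`|C| / (e / 2))).+1 => // -[//|n] /= nN.
have n0 : 0 < n.+1%:R :> R by rewrite ltr0n.
rewrite ler_pdivrMl//.
have := HC n.+1; rewrite sumrB sumr_const card_ord -[_ *+ n.+1]mulr_natl.
have : (Num.truncn (e / 2)^-1).+1%:R^-1 <= e / 2.
  by rewrite -[leRHS]invrK lef_pV2 ?posrE ?invr_gt0// ltW// truncnS_gt.
move: (_.+1%:R^-1) => k ke.
have : `|C| <= n.+1%:R * (e / 2).
  rewrite -ler_pdivrMr// (le_trans (ltW (truncnS_gt _)))//.
  by rewrite ler_nat.
have := ler_norm C; move: (n.+1%:R : R) n0 => N n0.
have : N * k <= N * (e / 2) by rewrite ler_pM2l.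
lra.
Qed.

(** The lower bound is the upper bound for [- g]. *)
Lemma birkhoff_ergodic_theorem (g : Y -> R) (B : R) :
  measurable_fun setT g -> (forall x, `|g x| <= B) ->
  {ae mu, forall x,
    (fun n : nat => n%:R^-1 * \sum_(i < n) g (iter i T x)) @ \oo
      --> \int[mu]_x g x}.
Proof.
move=> mg gB.
have mNg : measurable_fun setT (fun x => - g x) by exact: measurableT_comp.
have NgB x : `|- g x| <= B by rewrite normrN.
have IN : \int[mu]_x (- g x) = - \int[mu]_x g x.
  rewrite -mulN1r -RintegralZl//; last exact: (@bounded_integrable _ _ _ _ _ _ B).
  by apply: eq_Rintegral => x _; rewrite mulN1r.
apply: filterS2 (birkhoff_average_upper_bounded mg gB)
  (birkhoff_average_upper_bounded mNg NgB) => x ub lb.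
apply/cvgrPdist_le => e e0; near=> n.
rewrite distrC ler_distl; apply/andP; split; last first.
  by near: n; exact: ub.
have : n%:R^-1 * \sum_(i < n) - g (iter i T x) <= \int[mu]_x (- g x) + e.
  by near: n; exact: lb.
by rewrite IN sumrN mulrN; lra.
Unshelve. all: by end_near. Qed.

End ergodic_theorem.

(** * Continuous functions on a compact space *)

Lemma compact_unif_continuous (R : realType) (X : pseudoMetricType R)
    (g : X -> R) : compact [set: X] -> continuous g ->
  forall e, 0 < e -> exists2 r : R, 0 < r &
    forall x y, ball x r y -> `|g x - g y| <= e.
Proof.
move=> /compact_near_coveringP cX cg e e0.
have e20 : 0 < e / 2 by rewrite divr_gt0.
(* In its near-covering form, compactness turns an estimate valid near each point, for all small
   radii, into one valid at all points simultaneously. *)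
have := cX R 0^'+ (fun r x => forall y, ball x r y -> `|g x - g y| <= e) _.
move=> /(_ _)[].
  move=> x _; have /cvgrPdist_lt/(_ _ e20)/nbhs_ballP[r /= r0 xr] := cg x.
  have r20 : 0 < r / 2 by rewrite divr_gt0.
  (* Halving [r] keeps both [x'] and every [y] within [r / 2] of [x'] inside the ball of radius [r]
     about [x]. *)
  exists (ball x (r / 2), [set s | s <= r / 2]) => /=.
    by split; [exact: nbhsx_ballx|exact: nbhs_right_le].
  move=> [x' s] /= [xx' sr] y x'y.
  have gx' : `|g x - g x'| < e / 2.
    by apply: xr; apply: le_ball xx'; rewrite ler_pdivrMr// ler_peMr ?ltW//; lra.
  have gy : `|g x - g y| < e / 2.
    apply: xr; rewrite [r]splitr; apply: ball_triangle xx' _.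
    exact: le_ball x'y.
  rewrite (le_trans (ler_distD (g x) _ _))// [leRHS]splitr lerD// ltW//.
  by rewrite distrC.
move=> r /= r0 H.
exists (r / 2); first by rewrite divr_gt0.
move=> x y; apply: H => //=; rewrite ?divr_gt0//.
by rewrite sub0r normrN gtr0_norm ?divr_gt0// ltr_pdivrMr// ltr_pMr//; lra.
Qed.

Lemma compact_continuous_bounded (R : realType) (X : topologicalType)
    (g : X -> R) : compact [set: X] -> continuous g ->
  exists B, forall x, `|g x| <= B.
Proof.
move=> cX cg.
have /compact_bounded[M [_ HM]] : compact (g @` setT).
  by apply: continuous_compact => //; exact: continuous_subspaceT.
by exists (M + 1) => x; apply: (HM (M + 1)); [rewrite ltrDl|exists x].
Qed.

Lemma continuous_borel_measurable (R : realType) (X : ptopologicalType)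
    (g : X -> R) :
  continuous g -> measurable_fun setT (g : borel X -> R).
Proof.
move=> /continuousP cg; apply: (measurability _ (RGenOpens.measurableE R)).
move=> _ [_ [a [b ->] <-]]; rewrite setTI; apply: sub_sigma_algebra.
exact/cg/interval_open.
Qed.

(** * Means of triangular arrays and averages over a set *)

(** In row [k] the last [J] entries add up to at most [C *+ J], which is negligible after division
    by [k]; each of the other entries is at most [e / 2]. *)
Lemma triangular_mean_cvg0 (R : realType) (a : nat -> nat -> R) (C : R) :
  (forall k i, `|a k i| <= C) ->
  (forall e, 0 < e -> exists J, forall m i : nat, (i < m)%N ->
    `|a (m + J)%N i| <= e) ->
  (fun k : nat => k%:R^-1 * \sum_(i < k) a k i) @ \oo --> (0 : R).
Proof.
move=> aC aJ; apply/cvgrPdist_le => e e0.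
have e20 : 0 < e / 2 by rewrite divr_gt0.
have [J HJ] := aJ _ e20.
exists (J + (Num.truncn (C *+ J / (e / 2))).+1)%N => // k /= kJ.
have Jk : (J <= k)%N by rewrite (leq_trans _ kJ)// leq_addr.
have k0 : (0 < k)%N by rewrite (leq_trans _ kJ)// addnS.
rewrite sub0r normrN normrM gtr0_norm ?invr_gt0 ?ltr0n//.
rewrite ler_pdivrMl ?ltr0n// (le_trans (ler_norm_sum _ _ _))//.
have CJ : C *+ J <= k%:R * (e / 2).
  rewrite -ler_pdivrMr// (le_trans (ltW (truncnS_gt _)))// ler_nat.
  by rewrite (leq_trans _ kJ)// leq_addl.
rewrite -(subnK Jk) in CJ *; set m := (k - J)%N in CJ *.
rewrite big_split_ord /=.
have : \sum_(i < m) `|a (m + J)%N i| <= m%:R * (e / 2).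
  rewrite (le_trans (ler_sum _ (fun (i : 'I_m) _ => HJ m i (ltn_ord i))))//.
  by rewrite sumr_const card_ord mulr_natl.
have : \sum_(i < J) `|a (m + J)%N (m + i)%N| <= C *+ J.
  by rewrite (le_trans (ler_sum _ (fun i _ => aC _ _)))// sumr_const card_ord.
have : m%:R * (e / 2) <= (m + J)%:R * (e / 2).
  by rewrite ler_pM2r// ler_nat leq_addr.
have : (m + J)%:R * e = (m + J)%:R * (e / 2) + (m + J)%:R * (e / 2).
  by rewrite -mulrDr -splitr.
lra.
Qed.

Lemma average_dist_le d (Y : measurableType d) (R : realType)
    (mu : probability Y R) (A : set Y) (g : Y -> R) (B c e : R) :
  measurable A -> (0 < mu A)%E -> measurable_fun setT g ->
  (forall x, `|g x| <= B) -> (forall x, A x -> `|g x - c| <= e) ->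
  `|(fine (mu A))^-1 * \int[mu]_(x in A) g x - c| <= e.
Proof.
move=> mA A0 mg gB gc.
have Afin : mu A \is a fin_num.
  by rewrite ge0_fin_numE// (le_lt_trans (probability_le1 mu mA))// ltry.
have fA0 : 0 < fine (mu A) by rewrite -lte_fin fineK.
have ig : mu.-integrable A (EFin \o g) by exact: (@bounded_integrable _ _ _ _ _ _ B).
have ic k : mu.-integrable A (EFin \o cst k).
  exact: (@bounded_integrable _ _ _ _ _ (cst k) `|k|).
have igc : mu.-integrable A (EFin \o (fun x => g x - c)).
  apply: (@bounded_integrable _ _ _ _ _ _ (B + `|c|)) => //.
    exact: measurable_funB.
  by move=> x; rewrite (le_trans (ler_normB _ _))// lerD2r.
(* As [mu A] is positive and finite, the average of the constant [c] over [A] is [c]. *)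
have -> : (fine (mu A))^-1 * \int[mu]_(x in A) g x - c =
    (fine (mu A))^-1 * \int[mu]_(x in A) (g x - c).
  rewrite RintegralB//; last exact: ic.
  rewrite Rintegral_cst// mulrBr mulrCA mulVf ?mulr1//.
  by rewrite gt_eqF.
rewrite normrM gtr0_norm ?invr_gt0// ler_pdivrMl// mulrC.
rewrite (le_trans (le_normr_Rintegral _ _))//.
rewrite -Rintegral_cst// le_Rintegral//.
  exact: integrable_norm.
exact: ic.
Qed.

(** * Size, measurability and positivity of cylinders *)

Lemma lipschitz_iter (R : realType) (X : Type) (p : X -> X -> R) (L : R)
    (T : X -> X) i x y : 0 <= L -> lipschitz_wrt p L T ->
  p (iter i T x) (iter i T y) <= L ^+ i * p x y.
Proof.
move=> L0 pL; elim: i => [|i IHi]; first by rewrite expr0 mul1r.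
by rewrite !iterS (le_trans (pL _ _))// exprS -mulrA ler_wpM2l.
Qed.

(** The expansion [L ^+ i] against the decay [L ^- (m + J)] leaves [L ^- (m - i + J)], whose
    exponent is at least [J]. *)
Lemma cylinder_image_small (R : realType) (X : Type) (p : X -> X -> R)
    (T : X -> X) (L c r : R) (F : nat -> set X) (x : X) :
  1 < L -> lipschitz_wrt p L T ->
  (forall k y, F k y -> p x y <= c * L ^- k) -> 0 < r ->
  exists J, forall m i y, (i < m)%N -> F (m + J)%N y ->
    p (iter i T x) (iter i T y) < r.
Proof.
move=> L1 pL Fc r0; have L0 : 0 < L by lra.
have V0 : 0 < L^-1 by rewrite invr_gt0.
have V1 : `|L^-1| < 1 by rewrite gtr0_norm// invf_lt1.
(* [J] is a rank from which [|c| * L ^- n] stays below [r]. *)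
have /cvgrPdist_lt/(_ _ r0)[J _ HJ] := cvg_geometric `|c| V1.
exists J => m i y im Fy.
apply: le_lt_trans (lipschitz_iter i x y (ltW L0) pL) _.
apply: le_lt_trans (_ : L ^+ i * (`|c| * L ^- (m + J)) < _).
  rewrite ler_pM2l ?exprn_gt0// (le_trans (Fc _ _ Fy))//.
  by rewrite ler_wpM2r ?ler_norm// invr_ge0 exprn_ge0 ?ltW.
have := HJ (m - i + J)%N (leq_addl _ _).
rewrite sub0r normrN /= ger0_norm ?mulr_ge0 ?exprn_ge0 // ?ltW//.
congr (_ < r); rewrite mulrCA; congr (_ * _).
have -> : (m + J = i + (m - i + J))%N by rewrite addnA subnKC// ltnW.
by rewrite exprVn [in RHS]exprD invfM mulrA mulfV ?mul1r// expf_neq0 ?gt_eqF.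
Qed.

Lemma measurable_cylinder (R : realType) (X : pseudoPMetricType R) (T : X -> X)
    (D : finType) (E : D -> set X) (d : nat -> X -> D) k x :
  measurable_fun setT (T : borel X -> borel X) ->
  (forall c, measurable (E c : set (borel X))) ->
  measurable (cylinder T E d k x : set (borel X)).
Proof.
move=> mT mE; apply: bigcap_measurableType => i _.
rewrite -[X in measurable X]setTI.
exact: (measurable_iter i mT measurableT (mE _)).
Qed.

(** For fixed [k], every bad point lies in a null cylinder given by a word over [D]. There are
    countably many words, so these cylinders together are negligible. *)
Lemma cylinder_positive (R : realType) (X : pseudoPMetricType R)
    (mu : probability (borel X) R) (T : X -> X)
    (D : finType) (E : D -> set X) (d : nat -> X -> D) :
  measurable_fun setT (T : borel X -> borel X) ->
  (forall c, measurable (E c : set (borel X))) ->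
  (forall i x, E (d i x) (iter i T x)) ->
  {ae mu, forall x : borel X, forall k,
    (0 < mu (cylinder T E d k x : set (borel X)))%E}.
Proof.
move=> mT mE Ed; apply/ae_foralln => k.
(* The coding is replaced by one independent of the point, so [W s] depends on the word [s] only;
   the default letter is never read when [s] has length [k]. *)
pose W (s : seq D) : set (borel X) :=
  cylinder T E (fun i _ => nth (d 0 point) s i) k point.
pose N n := if unpickle n is Some s
  then if mu (W s) == 0%E then W s else set0 else set0.
have /negligibleS : mu.-negligible (\bigcup_n N n).
  apply: negligible_bigcup => n; rewrite /N; case: unpickle => [s|]; last first.
    exact: negligible_set0.
  case: eqP => [W0|_]; last exact: negligible_set0.
  by apply/negligibleP => //; exact: measurable_cylinder.
apply=> x /= Cx; pose s := mkseq (d^~ x) k.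
have WE : W s = cylinder T E d k x.
  by apply: eq_bigcapr => i /= ik; rewrite nth_mkseq.
exists (pickle s) => //; rewrite /N pickleK WE.
have := measure_ge0 mu (cylinder T E d k x : set (borel X)).
rewrite le_eqVlt => /predU1P[<-|]; last by [].
by rewrite eqxx => i _; exact: Ed.
Qed.

(** * Convergence for real-valued functions *)

Lemma cylinder_average_cvg (R : realType) (X : pseudoPMetricType R)
    (p : X -> X -> R) (L : R) (T : X -> X) (mu : probability (borel X) R)
    (D : finType) (E : D -> set X) (d : nat -> X -> D) (g : X -> R) :
  is_pseudometric p -> compact [set: X] -> 1 < L -> lipschitz_wrt p L T ->
  ergodic mu (T : borel X -> borel X) ->
  (forall c, measurable (E c : set (borel X))) ->
  (forall i x, E (d i x) (iter i T x)) ->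
  {ae mu, forall x : borel X, exists c : R, forall k : nat,
     (diam p (cylinder T E d k x) <= (c * L ^- k)%:E)%E} ->
  continuous g ->
  {ae mu, forall x : borel X,
    (fun k : nat => k%:R^-1 * \sum_(i < k)
       ((fine (mu (cylinder T E d k x : set (borel X))))^-1 *
        \int[mu]_(y in (cylinder T E d k x : set (borel X))) g (iter i T y)))
    @ \oo --> \int[mu]_(y in [set: borel X]) g y}.
Proof.
move=> [_ _ _ ballE] cX L1 pL erg mE Ed diamC cg; have [mT _ _] := erg.
have [B gB] := compact_continuous_bounded cX cg.
have mg := continuous_borel_measurable cg.
have B0 : 0 <= B by rewrite (le_trans _ (gB point)).
have C_gt0 := cylinder_positive mu mT mE Ed.
have birk := birkhoff_ergodic_theorem erg mg gB.
apply: filterS3 diamC C_gt0 birk => x [c Cc] C0.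
set F := fun k => (cylinder T E d k x : set (borel X)).
have mF k : measurable (F k) by exact: measurable_cylinder.
(* Since [x] lies in its own cylinder, the diameter bounds all distances from [x]. *)
have Fc k y : F k y -> p x y <= c * L ^- k.
  move=> Fy; rewrite -lee_fin (le_trans _ (Cc k))//; apply: ereal_sup_ubound.
  by exists (x, y) => //=; split=> // i _; exact: Ed.
have mgi i : measurable_fun setT ((g \o iter i T) : borel X -> R).
  exact: (measurableT_comp mg (measurable_iter i mT)).
pose av k i := (fine (mu (F k)))^-1 * \int[mu]_(y in F k) g (iter i T y).
pose a k i := av k i - g (iter i T x).
have a_le k i e : (forall y, F k y -> `|g (iter i T y) - g (iter i T x)| <= e) ->
    `|a k i| <= e.
  have := @average_dist_le _ (borel X) R mu (F k) (g \o iter i T) B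
    (g (iter i T x)) e.
  by apply=> //=; exact: C0.
have aC k i : `|a k i| <= B + B.
  by apply: a_le => y _; rewrite (le_trans (ler_normB _ _))// lerD.
have aJ e : 0 < e -> exists J, forall m i : nat, (i < m)%N ->
    `|a (m + J)%N i| <= e.
  move=> e0; have [r r0 gr] := compact_unif_continuous cX cg e0.
  have [J HJ] := cylinder_image_small L1 pL Fc r0.
  exists J => m i im; apply: a_le => y Fy.
  by rewrite distrC gr// ballE /=; exact: HJ im Fy.
(* The averages split into the means of the errors [a k i], which tend to 0, and the Birkhoff
   averages at [x]. *)
have avE : (fun k : nat => k%:R^-1 * \sum_(i < k) av k i) =
    (fun k : nat => k%:R^-1 * \sum_(i < k) a k i) \+
    (fun k : nat => k%:R^-1 * \sum_(i < k) g (iter i T x)).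
  apply/funext => k /=; rewrite -mulrDr -big_split /=; congr (_ * _).
  by apply: eq_bigr => i _; rewrite subrK.
move=> birk_x.
suff : (fun k : nat => k%:R^-1 * \sum_(i < k) av k i) @ \oo -->
  \int[mu]_(y in [set: borel X]) g y by [].
rewrite avE -[X in _ --> X]add0r.
by apply: cvgD; [exact: triangular_mean_cvg0 aC aJ|exact: birk_x].
Qed.

(** * Passage to complex values *)

Lemma norm_le_complex (R : realType) (z : R[i]) :
  `|z| <= (`|complex.Re z| + `|complex.Im z|)%:C%C.
Proof.
rewrite normc_def lecR; set a := complex.Re z; set b := complex.Im z.
rewrite -[leRHS]ger0_norm ?addr_ge0// -sqrtr_sqr ler_wsqrtr//.
rewrite -(real_normK (num_real a)) -(real_normK (num_real b)) sqrrD.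
by rewrite lerD2r lerDl mulrn_wge0// mulr_ge0.
Qed.

Lemma normr_Re_le (R : realType) (z : R[i]) : `|complex.Re z|%:C%C <= `|z|.
Proof.
by rewrite normc_def lecR -sqrtr_sqr ler_wsqrtr// lerDl sqr_ge0.
Qed.

Lemma normr_Im_le (R : realType) (z : R[i]) : `|complex.Im z|%:C%C <= `|z|.
Proof.
by rewrite normc_def lecR -sqrtr_sqr ler_wsqrtr// lerDr sqr_ge0.
Qed.

Lemma cvg_complex (R : realType) (S : Type) (F : set_system S) {FF : Filter F}
    (u : S -> R[i]^o) (l : R[i]^o) :
  (fun s => complex.Re (u s)) @ F --> complex.Re l ->
  (fun s => complex.Im (u s)) @ F --> complex.Im l ->
  u @ F --> l.
Proof.
move=> uRe uIm; apply/cvgrPdist_le => e e0.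
(* In the order of [R[i]], a positive number has zero imaginary part. *)
have [a a0 ea] : exists2 a : R, 0 < a & e = a%:C%C.
  by case: e e0 => a b; rewrite ltcE /= => /andP[/eqP-> a0]; exists a.
have a20 : 0 < a / 2 by rewrite divr_gt0.
near=> s.
rewrite (le_trans (norm_le_complex _))// ea lecR [leRHS]splitr !raddfB /=.
apply: lerD; near: s.
  by move/cvgrPdist_le : uRe; exact.
by move/cvgrPdist_le : uIm; exact.
Unshelve. all: by end_near. Qed.

Lemma cvg_Re_Im (R : realType) (S : Type) (F : set_system S) {FF : Filter F}
    (u : S -> R[i]^o) (l : R[i]^o) : u @ F --> l ->
  ((fun s => complex.Re (u s)) @ F --> complex.Re l) /\
  ((fun s => complex.Im (u s)) @ F --> complex.Im l).
Proof.
move=> /cvgrPdist_le ul.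
split; apply/cvgrPdist_le => e e0;
  have /ul : 0 < e%:C%C by [rewrite ltcR];
  apply: filterS => s us; rewrite -raddfB -lecR.
  exact: le_trans (normr_Re_le _) us.
exact: le_trans (normr_Im_le _) us.
Qed.

Theorem proposition3p2 (R : realType) (X : pseudoPMetricType R)
  (p : X -> X -> R) (L : R) (T : X -> X) (mu : probability (borel X) R)
  (D : finType) (E : D -> set X) (d : nat -> X -> D) (f : X -> R[i]^o)
  (p_pseudometric : is_pseudometric p)
  (X_compact : compact [set: X])
  (T_homeo : homeomorphism T)
  (L_gt1 : 1 < L)
  (T_lipschitz : lipschitz_wrt p L T)
  (mu_regular : regular_measure mu)
  (mu_ergodic : ergodic mu (T : borel X -> borel X))
  (E_generator : generator T E)
  (d_coding : forall i x, E (d i x) (iter i T x))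
  (diam_cylinder : {ae mu, forall x : borel X, exists g : R, forall k : nat,
     (diam p (cylinder T E d k x) <= (g * L ^- k)%:E)%E})
  (f_continuous : continuous f) :
  {ae mu, forall x : borel X,
    (fun k : nat => k%:R^-1 *
       \sum_(i < k) average mu (cylinder T E d k x : set (borel X))
                            (f \o iter i T)) @ \oo
    --> (cintegral mu [set: borel X] f : R[i]^o)}.
Proof.
have [mE _ _ _] := E_generator.
have fRe : continuous (fun x => complex.Re (f x)).
  by move=> x; have [] := cvg_Re_Im (f_continuous x).
have fIm : continuous (fun x => complex.Im (f x)).
  by move=> x; have [] := cvg_Re_Im (f_continuous x).
have Re_real (r : R) z : complex.Re (r%:C%C * z) = r * complex.Re z.
  by case: z => a b /=; rewrite mul0r subr0.
have Im_real (r : R) z : complex.Im (r%:C%C * z) = r * complex.Im z.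
  by case: z => a b /=; rewrite mul0r addr0.
(* The factor [1 / k] of the goal is complex; as an embedded real it commutes with taking real and
   imaginary parts. *)
have nE (k : nat) : k%:R^-1 = (k%:R^-1 : R)%:C%C by rewrite fmorphV rmorph_nat.
have key := cylinder_average_cvg p_pseudometric X_compact L_gt1 T_lipschitz
  mu_ergodic mE d_coding diam_cylinder.
apply: filterS2 (key _ fRe) (key _ fIm) => x cvRe cvIm.
apply: cvg_complex.
  apply: cvg_trans cvRe; apply: near_eq_cvg; apply: nearW => k.
  rewrite nE Re_real raddf_sum; congr (_ * _).
  by apply: eq_bigr => i _; rewrite /= mul0r subr0.
apply: cvg_trans cvIm; apply: near_eq_cvg; apply: nearW => k.
rewrite nE Im_real raddf_sum; congr (_ * _).
by apply: eq_bigr => i _; rewrite /= mul0r addr0.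
Qed.
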